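(* Let $\mathcal{H}$ be a Hilbert space and let $\{f_n\}_{n\in\mathbb{N}}\subset\mathcal{H}$ be a Bessel sequence of unit vectors, i.e. $\|f_n\|=1$ for all $n\in\mathbb{N}$ and there exists $B>0$ such that $$\sum_{n=0}^{\infty}|\langle x,f_n\rangle|^2\leq B\|x\|^2\quad\text{for all } x\in\mathcal{H}.$$ Then $\{f_n\}_{n\in\mathbb{N}}$ can be partitioned into finitely many uniformly separated sequences: there exist an integer $r\geq 1$ and a partition $\mathbb{N}=I_1\cup\dots\cup I_r$ into pairwise disjoint nonempty sets such that, for every $p\in\{1,\dots,r\}$, the sequence $\{f_n\}_{n\in I_p}$ is uniformly separated.
   Context: $\mathbb{N}=\{0,1,2,\dots\}$. For $I\subset\mathbb{N}$, a sequence $\{f_n\}_{n\in I}$ of unit vectors in a Hilbert space is called uniformly separated if $$\sup_{j\in I}\ \sum_{i\in I,\ i\neq j}|\langle f_i,f_j\rangle|^2<1.$$ *)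

(* Defs.v *)
From HB Require Import structures.
From mathcomp Require Import all_boot all_order all_algebra.
From mathcomp Require Import all_classical all_reals all_analysis.
From mathcomp Require Export complex.

Set Implicit Arguments.
Unset Strict Implicit.
Unset Printing Implicit Defensive.
Import Order.TTheory GRing.Theory Num.Theory.
Import numFieldNormedType.Exports.
Local Open Scope classical_set_scope.
Local Open Scope ring_scope.

(* Hilbert spaces are taken over the real numbers or over the complex numbers,
   and the definitions below are uniform in this choice. *)
Variant scalars := RealScalars | ComplexScalars.

Definition scalar_field (R : realType) (F : scalars) : numFieldType :=
  match F with RealScalars => R | ComplexScalars => R[i] end.

Definition scalar_conj (R : realType) (F : scalars) :
    scalar_field R F -> scalar_field R F :=
  match F with
  | RealScalars => idfun
  | ComplexScalars => (@Num.conj R[i] : R[i] -> R[i])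
  end.

Definition scalar_re (R : realType) (F : scalars) : scalar_field R F -> R :=
  match F with RealScalars => idfun | ComplexScalars => @complex.Re R end.

(* Norms of scalars and of vectors take their values in the scalar field;
   [rnorm x] is the norm of [x] as an element of [R]. *)
Definition rnorm (R : realType) (F : scalars)
    (V : normedZmodType (scalar_field R F)) (x : V) : R := scalar_re `|x|.

(* The inner product is linear in its first argument and conjugate-linear in
   the second one. *)
Record hilbertType (R : realType) (F : scalars) := HilbertType {
  hilbert_sort :> completeNormedModType (scalar_field R F);
  inner : {dot hilbert_sort for @scalar_conj R F};
  hilbert_normE : forall x : hilbert_sort, `|x| ^+ 2 = inner x x
}.

Definition bessel (R : realType) (F : scalars) (H : hilbertType R F)
    (f : nat -> H) : Prop :=
  exists B : R, 0 < B /\ forall x : H,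
    (\sum_(0 <= n <oo) (rnorm (inner H x (f n) : scalar_field R F) ^+ 2)%:E
       <= (B * rnorm x ^+ 2)%:E)%E.

(* [f] is only relevant on the index set [I]. *)
Definition uniformly_separated (R : realType) (F : scalars)
    (H : hilbertType R F) (I : set nat) (f : nat -> H) : Prop :=
  (forall n, I n -> rnorm (f n) = 1) /\
  (ereal_sup [set \esum_(i in I `\ j)
      (rnorm (inner H (f i) (f j) : scalar_field R F) ^+ 2)%:E | j in I] < 1)%E.

(* Main.v *)
(* On a finite index set, choose the partition into r classes minimizing the sum
   of the weights |<f_i, f_k>|^2 over ordered pairs of distinct indices lying in
   the same class.  Moving an index j to another class does not lower this sum,
   so the weights joining j to its own class add up to at most the average over
   all classes, hence to at most B / r.  This bound does not depend on the size
   of the index set, so it survives passing to a limit, along a free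
   ultrafilter, of optimal partitions of {0, .., n - 1}; any r > B then works. *)

Require Import Defs.
From mathcomp Require Import all_boot all_order all_algebra.
From mathcomp Require Import all_classical all_reals all_analysis.
Import Order.TTheory GRing.Theory Num.Theory.
Local Open Scope classical_set_scope.
Local Open Scope ring_scope.

Lemma in_class_sum_le_min (R : realDomainType) (T : finType) (r : nat)
    (a : T -> T -> R) : (forall i j, a i j = a j i) ->
  exists c : {ffun T -> 'I_r.+1}, forall j p,
    \sum_(i | (i != j) && (c i == c j)) a i j <=
    \sum_(i | (i != j) && (c i == p)) a i j.
Proof.
move=> a_sym.
pose E (c : {ffun T -> 'I_r.+1}) :=
  \sum_i \sum_(k | (k != i) && (c k == c i)) a i k.
(* Only the first summand depends on the class of [j]. *)
have EE c j : E c = (\sum_(i | (i != j) && (c i == c j)) a i j) *+ 2 +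
    \sum_(i | i != j) \sum_(k | (k != j) && ((k != i) && (c k == c i))) a i k.
  rewrite /E (bigD1 j)//= mulr2n -addrA; congr (_ + _).
    by apply: eq_bigr => i _; exact: a_sym.
  rewrite [in RHS]big_mkcondr -big_split/=; apply: eq_bigr => i ij.
  rewrite (bigID (pred1 j))/=; congr (_ + _); last first.
    by apply: eq_bigl => k; rewrite andbC.
  rewrite (eq_bigl (fun k => (k == j) && (c i == c j))) => [|k].
    by rewrite big_mkcondr big_pred1_eq.
  by rewrite andbC; case: eqP => [->|]//=; rewrite eq_sym ij eq_sym.
case: (@arg_minP _ R _ [ffun=> ord0] predT E) => //= c _ c_min.
exists c => j p.
(* The competitor moves [j] alone to class [p]; in [E c <= E c'] the common summand and the factor 2
   cancel. *)
pose c' : {ffun T -> 'I_r.+1} := [ffun i => if i == j then p else c i].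
have := c_min c' isT.
rewrite !(EE _ j).
have c'E i : i != j -> c' i = c i by rewrite ffunE => /negPf->.
have c'j : c' j = p by rewrite ffunE eqxx.
have -> : \sum_(i | i != j)
    \sum_(k | (k != j) && ((k != i) && (c' k == c' i))) a i k =
  \sum_(i | i != j) \sum_(k | (k != j) && ((k != i) && (c k == c i))) a i k.
  apply: eq_bigr => i ij; apply: eq_bigl => k.
  by case: (eqVneq k j) => //= kj; rewrite !c'E.
rewrite lerD2r lerMn2r/= => /le_trans; apply.
rewrite le_eqVlt; apply/predU1l/eq_bigl => i.
by case: (eqVneq i j) => //= ij; rewrite c'j c'E.
Qed.

(** Averaging: the sums from [j] to the [r.+1] classes add up to at most the full row sum, and the
    one to its own class is the smallest. *)
Lemma small_in_class_sums_finite (R : realFieldType) (T : finType) (r : nat)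
    (a : T -> T -> R) (B : R) :
  (forall i j, a i j = a j i) -> (forall i j, 0 <= a i j) ->
  (forall j, \sum_i a i j <= B) ->
  exists c : T -> 'I_r.+1, forall j,
    \sum_(i | (i != j) && (c i == c j)) a i j <= B / r.+1%:R.
Proof.
move=> a_sym a_ge0 aB; have [c c_min] := in_class_sum_le_min _ _ r _ a_sym.
exists c => j; rewrite ler_pdivlMr ?ltr0n// mulr_natr.
have -> : forall x : R, x *+ r.+1 = \sum_(p < r.+1) x.
  by move=> x; rewrite sumr_const card_ord.
apply: le_trans (ler_sum _ (fun p _ => c_min j p)) _.
rewrite -(partition_big c xpredT)//=; apply: le_trans (aB j).
by rewrite big_mkcond; apply: ler_sum => i _; case: ifP.
Qed.

(** Otherwise every fibre of [c] has its complement in [U], yet these finitely many complements have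
    empty intersection. *)
Lemma ultrafilter_finite_colour (X : Type) (T : finType) (U : set_system X)
    (c : X -> T) : UltraFilter U -> exists p, \forall x \near U, c x = p.
Proof.
move=> UU; apply: contrapT => /forallNP cU.
have : \forall x \near U, forall p, c x <> p.
  by apply: filter_forall => p; have [/cU|] := in_ultra_setVsetC [set x | c x = p] UU.
by move=> /filter_ex[x /(_ (c x))].
Qed.

(** Each bound on a partial sum involves finitely many classes only, which lets it pass to the limit
    colouring. *)
Lemma small_in_class_sums (R : realFieldType) (r : nat) (a : nat -> nat -> R)
    (B : R) :
  (forall i j, a i j = a j i) -> (forall i j, 0 <= a i j) ->
  (forall j n, \sum_(i < n) a i j <= B) ->
  exists c : nat -> 'I_r.+1, forall j n,
    \sum_(i < n | (i != j :> nat) && (c i == c j)) a i j <= B / r.+1%:R.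
Proof.
move=> a_sym a_ge0 aB.
have fin n : exists c : 'I_n -> 'I_r.+1, forall j : 'I_n,
    \sum_(i < n | (i != j) && (c i == c j)) a i j <= B / r.+1%:R.
  by apply: small_in_class_sums_finite.
have /choice[c cP] n : exists c : nat -> 'I_r.+1, forall j, (j < n)%N ->
    \sum_(i < n | (i != j :> nat) && (c i == c j)) a i j <= B / r.+1%:R.
  (* The default class [ord0] outside ['I_n] is harmless: the bound only reads indices below [n]. *)
  have [d dP] := fin n; pose d' i := oapp d ord0 (insub i).
  have d'E (i : 'I_n) : d' i = d i by rewrite /d' valK.
  exists d' => j jn.
  apply: le_trans (dP (Ordinal jn)).
  rewrite le_eqVlt; apply/predU1l/eq_bigl => i.
  by rewrite d'E (d'E (Ordinal jn)).
have [U [UU ooU]] := @ultraFilterLemma _ \oo _.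
have /choice[d dP] i := ultrafilter_finite_colour _ _ _ (c^~ i) UU.
exists d => j n; near U => N.
(* The range [maxn n j.+1] covers both the summation indices and [j] itself. *)
have cd (i : 'I_(maxn n j.+1)) : c N i = d i.
  move: i; near: N; exact: filter_forall.
have nN : (maxn n j.+1 <= N)%N by near: N; apply: ooU; exact: nbhs_infty_ge.
have jN : (j < N)%N by rewrite (leq_trans _ nN)// leq_maxr.
apply: le_trans (cP N j jN).
have -> : d j = c N j by rewrite (cd (Ordinal (leq_maxr n j.+1))).
(* Extending the sum from [n] to [N] only adds nonnegative terms. *)
rewrite (big_ord_widen_cond N (fun i => (i != j) && (d i == c N j)) (a^~ j)).
  rewrite big_mkcond [leRHS]big_mkcond; apply: ler_sum => i _.
  case: (ltnP i n) => [ilt|_]; last by rewrite andbF; case: ifP.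
  have im : (i < maxn n j.+1)%N by rewrite (leq_trans ilt)// leq_maxl.
  by rewrite andbT -(cd (Ordinal im)).
by rewrite (leq_trans _ nN)// leq_maxl.
Unshelve. all: by end_near. Qed.

Lemma rnorm_innerC (R : realType) (F : scalars) (H : hilbertType R F)
    (x y : H) :
  rnorm (inner H x y : scalar_field R F) = rnorm (inner H y x : scalar_field R F).
Proof.
have -> : inner H x y = (-1) ^+ false * scalar_conj (inner H y x).
  exact: hermitian_subproof.
rewrite expr0 mul1r /rnorm; congr (scalar_re _).
by case: F H x y => // H x y; exact: norm_conjC.
Qed.

Theorem theorem7 (R : realType) (F : scalars) (H : hilbertType R F)
    (f : nat -> H) :
  (forall n, rnorm (f n) = 1) -> bessel f ->
  exists (r : nat) (I : 'I_r -> set nat),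
    [/\ (1 <= r)%N, partition setT I setT &
        forall p : 'I_r, uniformly_separated (I p) f].
Proof.
move=> f1 [B [B0 fB]].
pose a i j := rnorm (inner H (f i) (f j) : scalar_field R F) ^+ 2.
have a_ge0 i j : 0 <= a i j by exact: sqr_ge0.
have aC i j : a i j = a j i by rewrite /a rnorm_innerC.
have aB j n : \sum_(i < n) a i j <= B.
  have := fB (f j); rewrite f1 expr1n mulr1 => /(le_trans _)/=.
  under eq_bigr do rewrite aC.
  rewrite -(big_mkord xpredT (a j)) -lee_fin -sumEFin; apply.
  by apply: nneseries_lim_ge => i _ _; rewrite lee_fin.
(* This choice gives [B < r.+1], hence [B / r.+1 < 1]. *)
pose r := Num.truncn B.
have [c cP] := small_in_class_sums _ r a B aC a_ge0 aB.
pose C := [set p | `[< exists n, c n = p >]]%SET.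
have cC n : c n \in C by rewrite inE; apply/asboolP; exists n.
exists #|C|, (fun q => c @^-1` [set enum_val q]); split.
- by apply/card_gt0P; exists (c 0%N).
- split.
  + apply/seteqP; split=> // n _; exists (enum_rank_in (cC 0%N) (c n)) => //=.
    by rewrite enum_rankK_in.
  + by move=> p q _ _ [n [/= -> /enum_val_inj]].
  + move=> q _; have := enum_valP q; rewrite inE => /asboolP[n cn].
    by exists n.
- move=> q; split=> //.
  (* A bound independent of [j] keeps the supremum strictly below 1. *)
  apply: (@le_lt_trans _ _ (B / r.+1%:R)%:E); last first.
    by rewrite lte_fin ltr_pdivrMr ?ltr0n// mul1r truncnS_gt.
  apply: ge_ereal_sup => _ [j /= cj <-].
  rewrite (_ : _ `\ j = [set i | (i != j) && (c i == c j)]); last first.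
    apply/seteqP; split=> i /=; first by move=> [ci /eqP ij]; rewrite ij ci cj eqxx.
    by move=> /andP[/eqP ij /eqP ->]; split.
  rewrite -nneseries_esum => [|i _]; last by rewrite lee_fin sqr_ge0.
  apply: lime_le.
    by apply: is_cvg_nneseries => i _ _; rewrite lee_fin sqr_ge0.
  by apply: nearW => n; rewrite sumEFin lee_fin big_mkord.
Qed.
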